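(* Let $n\ge 3$ and let $F_n$ be a cycle on $n$ vertices. Then $F_n$ is potentially triangulable in the convex complete graph $K_n$ if and only if $n\ge 7$.
   Context: A convex complete graph $K_n$ is the complete graph on $n$ points in convex position in the plane, edges drawn as straight-line segments. For a subgraph $F$ of $K_n$, $K_n-F$ is obtained by deleting the edges of $F$ (all vertices kept). A convex graph on $n$ vertices admits a triangulation if it contains all $n$ boundary edges (edges between vertices consecutive along the convex hull boundary) and $n-3$ pairwise non-crossing diagonals. A graph $F$ with at most $n$ vertices is potentially triangulable in $K_n$ if there is an embedding of $F$ as a subgraph of $K_n$ (an injective placement of its vertices on the vertices of $K_n$, edges becoming the corresponding edges of $K_n$) such that $K_n-F$ admits a triangulation. *)

(* Defs.v *)
From mathcomp Require Import all_boot all_order all_algebra.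
From mathcomp Require Import reals.

Set Implicit Arguments.
Unset Strict Implicit.
Unset Printing Implicit Defensive.

Import Order.TTheory GRing.Theory Num.Theory.
Local Open Scope ring_scope.

(* Finite simple graphs: edges are 2-element sets of vertices. *)
Record sgraph (V : finType) := SGraph {
  edges : {set {set V}};
  edges_card2 : forall e, e \in edges -> #|e| = 2%N
}.

(* c lists every vertex exactly once, and the edges are exactly the pairs of
   cyclically consecutive entries of c. This is a cycle in the usual sense
   for #|V| >= 3. *)
Definition is_cycle_graph (V : finType) (F : sgraph V) : Prop :=
  exists c : seq V,
    [/\ uniq c, forall x, x \in c
      & edges F = [set [set x; next c x] | x : V]].

Definition complete_edges (n : nat) : {set {set 'I_n}} :=
  [set e : {set 'I_n} | #|e| == 2%N].

Section ConvexGraphs.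
Variables (R : realType) (n : nat) (p : 'I_n -> 'rV[R]_2).

Definition in_hull (P : pred 'I_n) (x : 'rV[R]_2) : Prop :=
  exists w : 'I_n -> R,
    [/\ forall j, 0 <= w j, forall j, ~~ P j -> w j = 0,
        \sum_j w j = 1 & x = \sum_j w j *: p j].

(* Strict convex position: every point is a vertex of the convex hull. The
   indices only name the points; they need not follow the hull boundary. *)
Definition convex_position : Prop :=
  injective p /\ forall i, ~ in_hull (predC1 i) (p i).

(* [p i, p j] is an edge of the convex hull: some line through p i and p j
   has every other point strictly on the same side. *)
Definition boundary_edge (e : {set 'I_n}) : Prop :=
  exists i j, [/\ i != j, e = [set i; j]
    & exists (u : 'cV[R]_2) (c : R),
        [/\ (p i *m u) 0 0 = c, (p j *m u) 0 0 = c
          & forall k, k \notin e -> (p k *m u) 0 0 < c]].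

Definition diagonal (e : {set 'I_n}) : Prop := #|e| = 2%N /\ ~ boundary_edge e.

Definition in_open_segment (e : {set 'I_n}) (x : 'rV[R]_2) : Prop :=
  exists i j, [/\ i != j, e = [set i; j]
    & exists t : R, 0 < t < 1 /\ x = (1 - t) *: p i + t *: p j].

(* Sharing only an endpoint is not a crossing. *)
Definition crossing (e f : {set 'I_n}) : Prop :=
  exists x, in_open_segment e x /\ in_open_segment f x.

(* G is the edge set of a subgraph of the convex complete graph on p. *)
Definition admits_triangulation (G : {set {set 'I_n}}) : Prop :=
  (forall e, boundary_edge e -> e \in G) /\
  exists D : {set {set 'I_n}},
    [/\ D \subset G, #|D| = (n - 3)%N, forall e, e \in D -> diagonal e
      & forall e f, e \in D -> f \in D -> e != f -> ~ crossing e f].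

Definition potentially_triangulable (V : finType) (F : sgraph V) : Prop :=
  exists h : V -> 'I_n, injective h /\
    admits_triangulation
      (complete_edges n :\: [set [set h x | x in e] | e : {set V} in edges F]).

End ConvexGraphs.

(* Main.v *)
(* Convex position lets us number the points counterclockwise, so that hull
   edges join cyclically consecutive numbers and two segments cross exactly
   when their endpoints interleave.
   If n <= 6, every vertex has two hull neighbours and two neighbours in the
   cycle, hence lies on at most n - 5 diagonals of the triangulation. This
   leaves only n = 6, where the three diagonals would form a non-crossing
   perfect matching of the hexagon by diagonals, which does not exist.
   If n >= 7, fix the heptagon triangulation 16, 15, 25, 24 and add the ears
   0k for 6 <= k <= n - 2. The cycle 5 0 2 6 4 1 3 avoids the heptagon
   triangulation and can be extended one vertex at a time. *)
Require Import Defs.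
From mathcomp Require Import all_boot all_order all_algebra.
From mathcomp Require Import reals.
From mathcomp Require Import zify ring lra.

Set Implicit Arguments.
Unset Strict Implicit.
Unset Printing Implicit Defensive.

Import Order.TTheory GRing.Theory Num.Theory.
Local Open Scope ring_scope.

(** * Orientation of triples of points in convex position *)

(** Twice the signed area of the triangle [a b c], positive when it is counterclockwise. *)
Definition orient (R : realType) (a b c : 'rV[R]_2) : R :=
  (b 0 0 - a 0 0) * (c 0 1 - a 0 1) - (b 0 1 - a 0 1) * (c 0 0 - a 0 0).

Lemma ord2P (k : 'I_2) : k = 0 \/ k = 1.
Proof. by case: k => [[|[|]]] // ?; [left | right]; apply: val_inj. Qed.

Lemma row2P (R : realType) (x y : 'rV[R]_2) :
  x 0 0 = y 0 0 -> x 0 1 = y 0 1 -> x = y.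
Proof.
move=> e0 e1; apply/rowP => j; by case: (ord2P j) => ->.
Qed.

(** The form in which convex position is applied below. The weights need not sum to 1, so
    orientations can serve as weights directly, and [j], [k], [l] may coincide, so betweenness on a
    segment is covered too. *)
Lemma convex_position_bary (R : realType) (n : nat) (p : 'I_n -> 'rV[R]_2)
    (i j k l : 'I_n) (a b c : R) :
  convex_position p -> j != i -> k != i -> l != i ->
  0 <= a -> 0 <= b -> 0 <= c -> 0 < a + b + c ->
  a * p j 0 0 + b * p k 0 0 + c * p l 0 0 = (a + b + c) * p i 0 0 ->
  a * p j 0 1 + b * p k 0 1 + c * p l 0 1 = (a + b + c) * p i 0 1 -> False.
Proof.
move=> [_ hull] ji ki li a0 b0 c0 abc0 eX eY.
set S := a + b + c in abc0 eX eY; have S0 : S != 0 by rewrite gt_eqF.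
apply: (hull i).
have sum1 (d : 'I_n) (V : lmodType R) (f : 'I_n -> V) (r : R) :
  \sum_m (r * (m == d)%:R) *: f m = r *: f d.
  rewrite (bigD1 d) //= eqxx mulr1 big1 ?addr0 // => m /negbTE->.
  by rewrite mulr0 scale0r.
pose w m := a / S * (m == j)%:R + b / S * (m == k)%:R + c / S * (m == l)%:R.
have sumw (V : lmodType R) (f : 'I_n -> V) :
  \sum_m w m *: f m = (a / S) *: f j + (b / S) *: f k + (c / S) *: f l.
  rewrite -!sum1 -!big_split /=; apply: eq_bigr => m _.
  by rewrite /w !scalerDl.
exists w; split.
- by move=> m; rewrite /w !addr_ge0 // mulr_ge0 // ?divr_ge0 // ltW.
- move=> m /=; rewrite negbK => /eqP->.
  by rewrite /w ![i == _]eq_sym (negbTE ji) (negbTE ki) (negbTE li) !mulr0 !addr0.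
(* Viewing [R] as the module [R^o] lets [sumw] compute the total weight as well. *)
- transitivity (\sum_m w m *: (1 : R^o)).
    by apply: eq_bigr => m _; rewrite /GRing.scale /= mulr1.
  by rewrite sumw /GRing.scale /= !mulr1 -!mulrDl divff.
- rewrite sumw; apply: row2P; rewrite !mxE; apply: (mulfI S0).
    rewrite -eX; field.
    exact: S0.
  rewrite -eY; field.
  exact: S0.
Qed.

(** Of three collinear points one lies between the other two, against convex position. *)
Lemma orient_neq0 (R : realType) (n : nat) (p : 'I_n -> 'rV[R]_2)
    (i j k : 'I_n) :
  convex_position p -> i != j -> i != k -> j != k ->
  orient (p i) (p j) (p k) != 0.
Proof.
move=> cp ij ik jk; apply/eqP; rewrite /orient => o0.
have pij : (p j 0 0 - p i 0 0 != 0) || (p j 0 1 - p i 0 1 != 0).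
  rewrite -negb_and !subr_eq0; apply: contra ij => /andP[/eqP e0 /eqP e1].
  by rewrite eq_sym; apply/eqP/(proj1 cp)/row2P.
have bary := convex_position_bary cp.
move: (bary i j k k) (bary k i j j) (bary j i k k); clear bary.
move: (p i 0 0) (p i 0 1) (p j 0 0) (p j 0 1) (p k 0 0) (p k 0 1) o0 pij.
move=> xi yi xj yj xk yk o0 pij Bi Bk Bj.
(* With [s] the scalar product and [d] the squared distance from [p i] to [p j], collinearity gives
   [p k = p i + (s / d)(p j - p i)]. The middle point is [i], [k] or [j] according to [s < 0],
   [0 <= s <= d] or [d < s]. *)
pose s := (xj - xi) * (xk - xi) + (yj - yi) * (yk - yi).
pose d := (xj - xi) ^+ 2 + (yj - yi) ^+ 2.
have d0 : 0 < d.
  rewrite /d; case/orP: pij => ne0.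
    by rewrite ltr_pwDl ?sqr_ge0 // exprn_even_gt0.
  by rewrite ltr_pwDr ?sqr_ge0 // exprn_even_gt0.
have eX : d * (xk - xi) = s * (xj - xi).
  have -> : d * (xk - xi) = s * (xj - xi) - (yj - yi) *
    ((xj - xi) * (yk - yi) - (yj - yi) * (xk - xi)) by rewrite /s /d; ring.
  by rewrite o0 mulr0 subr0.
have eY : d * (yk - yi) = s * (yj - yi).
  have -> : d * (yk - yi) = s * (yj - yi) + (xj - xi) *
    ((xj - xi) * (yk - yi) - (yj - yi) * (xk - xi)) by rewrite /s /d; ring.
  by rewrite o0 mulr0 addr0.
clearbody d s.
have [s0|s0] := ltP s 0.
  apply: (Bi (- s) d 0) => //; rewrite 1?eq_sym //; lra.
have [sd|sd] := leP s d.
  apply: (Bk (d - s) s 0) => //; rewrite 1?eq_sym //; lra.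
apply: (Bj (s - d) d 0) => //; rewrite 1?eq_sym //; lra.
Qed.

(** Otherwise [p x] would lie in the triangle [i j k]: its barycentric weights are the areas of the
    three subtriangles at [p x], all nonnegative. *)
Lemma orient_trans (R : realType) (n : nat) (p : 'I_n -> 'rV[R]_2)
    (x i j k : 'I_n) :
  convex_position p -> i != x -> j != x -> k != x ->
  0 <= orient (p x) (p i) (p j) -> 0 <= orient (p x) (p j) (p k) ->
  0 <= orient (p x) (p i) (p k).
Proof.
move=> cp ix jx kx oij ojk; rewrite leNgt; apply/negP => oik.
apply: (@convex_position_bary _ _ p x i j k (orient (p x) (p j) (p k))
  (- orient (p x) (p i) (p k)) (orient (p x) (p i) (p j))) => //.
- by rewrite oppr_ge0 ltW.
- by rewrite -addrA ltr_wpDl // ltr_pwDl ?oppr_gt0.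
- by rewrite /orient; ring.
- by rewrite /orient; ring.
Qed.

(** Seen from [x], the point [j] lies in direction between [i] and [k]. A clockwise turn at [j]
    would put [p j] inside the triangle [x i k], again with subtriangle areas as weights. *)
Lemma orient_inner (R : realType) (n : nat) (p : 'I_n -> 'rV[R]_2)
    (x i j k : 'I_n) :
  convex_position p -> i != j -> j != x -> k != j ->
  0 < orient (p x) (p i) (p j) -> 0 < orient (p x) (p j) (p k) ->
  0 < orient (p x) (p i) (p k) -> 0 <= orient (p i) (p j) (p k).
Proof.
move=> cp ij jx kj oij ojk oik; rewrite leNgt; apply/negP => o.
apply: (@convex_position_bary _ _ p j x i k (- orient (p i) (p j) (p k))
  (orient (p x) (p j) (p k)) (orient (p x) (p i) (p j))) => //.
- by rewrite eq_sym.
- by rewrite oppr_ge0 ltW.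
- exact: ltW.
- exact: ltW.
- by do 2![apply: addr_gt0 => //]; rewrite oppr_gt0.
- by rewrite /orient; ring.
- by rewrite /orient; ring.
Qed.

Lemma orientC (R : realType) (a b c : 'rV[R]_2) :
  orient a c b = - orient a b c.
Proof. by rewrite /orient; ring. Qed.

Lemma orient_rot (R : realType) (a b c : 'rV[R]_2) :
  orient b c a = orient a b c.
Proof. by rewrite /orient; ring. Qed.

(** * Counterclockwise numbering of the points *)

(** Labels are plain naturals, so that label arithmetic is left to [lia]; nothing is required of [s]
    at [n] and beyond. *)
Definition ccw_labelling (R : realType) (n : nat) (p : 'I_n -> 'rV[R]_2)
    (s : nat -> 'I_n) (pos : 'I_n -> nat) : Prop :=
  [/\ forall x, (pos x < n)%N, cancel pos s,
      forall i, (i < n)%N -> pos (s i) = i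
    & forall i j k, (i < j < k)%N -> (k < n)%N ->
        0 < orient (p (s i)) (p (s j)) (p (s k))].

(* Seen from a hull vertex x, the other points span an angle less than pi, so
   sorting them by angle lists the hull counterclockwise. *)
Lemma ccw_labelling_exists (R : realType) (n : nat) (p : 'I_n -> 'rV[R]_2) :
  (0 < n)%N -> convex_position p ->
  exists (s : nat -> 'I_n) (pos : 'I_n -> nat), ccw_labelling p s pos.
Proof.
move=> n0 cp; pose x := Ordinal n0.
pose le i j := 0 <= orient (p x) (p i) (p j).
pose T := sort le (enum (predC1 x)); pose L := x :: T.
have memT i : (i \in T) = (i != x) by rewrite mem_sort mem_enum.
have uL : uniq L by rewrite /= memT eqxx sort_uniq enum_uniq.
have mL i : i \in L by rewrite inE memT orbN.
have sL : size L = n.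
  by rewrite -(card_uniqP uL) -[RHS]card_ord; apply: eq_card => i; rewrite mL.
have allx : all (predC1 x) (enum (predC1 x)).
  by apply/allP => i; rewrite mem_enum.
have srt : pairwise le T.
  (* The angular order is transitive only away from [x], hence the relativised sorting lemmas. *)
  have tr : {in predC1 x & &, transitive le}.
    by move=> j i k jx ix kx ij jk; apply: orient_trans ij jk.
  rewrite -(sorted_pairwise_in tr) ?all_sort //.
  apply: (sort_sorted_in _ allx) => i j _ _.
  by rewrite /le [orient _ (p j) _]orientC oppr_ge0 le_total.
exists (nth x L), (fun i => index i L); split.
- by move=> i; have := mL i; rewrite -index_mem sL.
- by move=> i; apply: nth_index.
- by move=> i ni; rewrite index_uniq ?sL.
have nthx i : (i.+1 < n)%N -> nth x T i \in T
  by move=> ni; apply: mem_nth; move: ni sL => /=; lia.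
have neq i j : (i < j < n)%N -> nth x L i != nth x L j.
  by move=> /andP[ij jn]; rewrite nth_uniq ?sL ?neq_ltn ?ij // (ltn_trans ij).
have xlt i j : (i < j)%N -> (j.+1 < n)%N ->
    0 < orient (p x) (p (nth x T i)) (p (nth x T j)).
  move=> ij jn; rewrite lt_neqAle eq_sym orient_neq0 //=.
  + move/(pairwiseP x): srt; apply=> //=; rewrite inE; move: jn sL => /=; lia.
  + by apply: (@neq 0%N i.+1); lia.
  + by apply: (@neq 0%N j.+1); lia.
  + by apply: (@neq i.+1 j.+1); lia.
(* Label 0 is [x] itself. A triple containing it is settled by the angular order; any other one by
   [orient_inner], made strict by [orient_neq0]. *)
move=> [|i] [|j] [|k] ijk kn; try lia; rewrite /=; first by apply: xlt; lia.
rewrite lt_neqAle eq_sym orient_neq0 //.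
- apply: (@orient_inner _ _ p x) => //.
  + by apply: (@neq i.+1 j.+1); lia.
  + by rewrite -memT nthx //; lia.
  + by rewrite eq_sym; apply: (@neq j.+1 k.+1); lia.
  + by apply: xlt; lia.
  + by apply: xlt; lia.
  + by apply: xlt; lia.
- by apply: (@neq i.+1 j.+1); lia.
- by apply: (@neq i.+1 k.+1); lia.
- by apply: (@neq j.+1 k.+1); lia.
Qed.

(** * Hull edges and crossings read off from the labels *)

(** Intended for [a < b]; the second disjunct is the hull edge closing the cycle of labels. *)
Definition hull_adjacent (n a b : nat) : bool :=
  (b == a.+1) || ((a == 0%N) && (b.+1 == n)).

Lemma hull_adjacent_boundary (R : realType) (n : nat) (p : 'I_n -> 'rV[R]_2)
    (s : nat -> 'I_n) (pos : 'I_n -> nat) (a b : nat) :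
  ccw_labelling p s pos -> (a < b < n)%N -> hull_adjacent n a b ->
  boundary_edge p [set s a; s b].
Proof.
move=> [posn posK sK ccw] abn adj.
have abs : s a != s b.
  by apply/eqP => /(congr1 pos); rewrite !sK; lia.
have ine k : k \notin [set s a; s b] -> [/\ pos k != a, pos k != b & (pos k < n)%N].
  rewrite !inE negb_or => /andP[ka kb]; split=> //.
    by apply: contra ka => /eqP<-; rewrite posK.
  by apply: contra kb => /eqP<-; rewrite posK.
(* A normal to the line through [s a] and [s b], pointing to its right for [e = 1]. The sign [e]
   makes it point outwards: the other points lie to the left for consecutive labels, and to the
   right for the closing edge, which runs from 0 to [n - 1]. *)
pose u e : 'cV[R]_2 := \col_i (if i == 0 then e * (p (s b) 0 1 - p (s a) 0 1)
  else e * (p (s a) 0 0 - p (s b) 0 0)).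
have uE e (q : 'rV[R]_2) : (q *m u e) 0 0 =
    (p (s a) *m u e) 0 0 - e * orient (p (s a)) (p (s b)) q.
  have sum2 (f : 'I_2 -> R) : \sum_i f i = f 0 + f 1.
    rewrite !big_ord_recl big_ord0 addr0; congr (_ + f _); exact: val_inj.
  by rewrite !mxE !sum2 !mxE /= /orient; ring.
suff [e oe] : exists e : R, forall k, k \notin [set s a; s b] ->
    0 < e * orient (p (s a)) (p (s b)) (p k).
  exists (s a), (s b); split=> //; exists (u e), ((p (s a) *m u e) 0 0); split=> //.
    by rewrite uE /orient; ring.
  by move=> k /oe ke; rewrite uE ltrBlDr ltrDl.
move: adj; rewrite /hull_adjacent => /orP[/eqP bE | /andP[/eqP aE /eqP bE]].
  exists 1 => k /ine[ka kb kn]; rewrite mul1r -[k]posK.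
  have [?|?] := ltnP (pos k) a; last by apply: ccw; lia.
  by rewrite orient_rot; apply: ccw; lia.
exists (- 1) => k /ine[ka kb kn]; rewrite mulN1r -orientC -[k]posK.
by apply: ccw; lia.
Qed.

(* The intersection point of the diagonals of the convex quadrilateral
   a < b < c < d, from the affine dependency of its vertices. *)
Lemma interleaved_crossing (R : realType) (n : nat) (p : 'I_n -> 'rV[R]_2)
    (s : nat -> 'I_n) (pos : 'I_n -> nat) (a b c d : nat) :
  ccw_labelling p s pos -> (a < b < c)%N -> (c < d < n)%N ->
  crossing p [set s a; s c] [set s b; s d].
Proof.
move=> [posn posK sK ccw] abc cdn.
have neq i j : (i < j < n)%N -> s i != s j.
  by move=> ijn; apply/eqP => /(congr1 pos); rewrite !sK; lia.
have [A B C D] : [/\ 0 < orient (p (s b)) (p (s c)) (p (s d)),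
  0 < orient (p (s a)) (p (s c)) (p (s d)),
  0 < orient (p (s a)) (p (s b)) (p (s d)) &
  0 < orient (p (s a)) (p (s b)) (p (s c))] by split; apply: ccw; lia.
have nac : s a != s c by apply: neq; lia.
have nbd : s b != s d by apply: neq; lia.
have E : orient (p (s b)) (p (s c)) (p (s d)) + orient (p (s a)) (p (s b)) (p (s d))
  = orient (p (s a)) (p (s c)) (p (s d)) + orient (p (s a)) (p (s b)) (p (s c)).
  by rewrite /orient; ring.
have cross k : (p (s a)) 0 k * orient (p (s b)) (p (s c)) (p (s d)) +
    (p (s c)) 0 k * orient (p (s a)) (p (s b)) (p (s d)) =
    (p (s b)) 0 k * orient (p (s a)) (p (s c)) (p (s d)) +
    (p (s d)) 0 k * orient (p (s a)) (p (s b)) (p (s c)).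
  by case: (ord2P k) => ->; rewrite /orient; ring.
move: A B C D E cross; set o1 := orient _ _ _; set o2 := orient _ _ _.
set o3 := orient _ _ _; set o4 := orient _ _ _ => A B C D E cross.
have S0 : 0 < o1 + o3 by apply: addr_gt0.
exists ((1 - o3 / (o1 + o3)) *: p (s a) + (o3 / (o1 + o3)) *: p (s c)); split.
  exists (s a), (s c); split=> //; exists (o3 / (o1 + o3)); split=> //.
  by rewrite divr_gt0 // ltr_pdivrMr // mul1r ltrDr.
exists (s b), (s d); split=> //; exists (o4 / (o1 + o3)); split.
  by rewrite divr_gt0 // ltr_pdivrMr // mul1r E ltrDr.
have Sn0 : o1 + o3 != 0 by rewrite gt_eqF.
apply/rowP => k; rewrite !mxE; apply: (mulfI Sn0).
transitivity ((p (s a)) 0 k * o1 + (p (s c)) 0 k * o3); first by field.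
rewrite cross.
have -> : o2 = o1 + o3 - o4 by rewrite E addrK.
by field.
Qed.

(** A pair that is not adjacent is crossed by a segment between two other points. Both ends of that
    segment lie strictly below the supporting line, yet the crossing point lies on it. *)
Lemma boundary_hull_adjacent (R : realType) (n : nat) (p : 'I_n -> 'rV[R]_2)
    (s : nat -> 'I_n) (pos : 'I_n -> nat) (a b : nat) :
  ccw_labelling p s pos -> (a < b < n)%N ->
  boundary_edge p [set s a; s b] -> hull_adjacent n a b.
Proof.
move=> ccwp abn [i [j [ij eij [u [c [ui uj ulow]]]]]].
have [posn posK sK _] := ccwp.
apply/negPn/negP => nadj.
have line x : in_open_segment p [set s a; s b] x -> (x *m u) 0 0 = c.
  move=> [i' [j' [_ e' [t [_ ->]]]]].
  have uc k : k \in [set s a; s b] -> (p k *m u) 0 0 = c.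
    by rewrite eij => /set2P[]->.
  rewrite mulmxDl -!scalemxAl [LHS]mxE [X in X + _]mxE [X in _ + X]mxE !uc.
  - by ring.
  - by rewrite e' !inE eqxx orbT.
  - by rewrite e' !inE eqxx.
have below k m x : (k < n)%N -> (m < n)%N -> k != a -> k != b -> m != a -> m != b ->
    in_open_segment p [set s k; s m] x -> (x *m u) 0 0 < c.
  move=> kn mn ka kb ma mb [i' [j' [_ e' [t [/andP[t0 t1] ->]]]]].
  have sneq k' l' : (k' < n)%N -> (l' < n)%N -> k' != l' -> s k' != s l'.
    move=> ? ? kl; apply: contra kl => /eqP/(congr1 pos); rewrite !sK // => ->.
    exact: eqxx.
  have uc l : l \in [set s k; s m] -> (p l *m u) 0 0 < c.
    by move=> lkm; apply: ulow; move: lkm => /set2P[]->; rewrite !inE negb_or !sneq //; lia.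
  rewrite mulmxDl -!scalemxAl [X in X < _]mxE [X in X + _]mxE [X in _ + X]mxE.
  have ui' : (p i' *m u) 0 0 < c by apply: uc; rewrite e' !inE eqxx.
  have uj' : (p j' *m u) 0 0 < c by apply: uc; rewrite e' !inE eqxx orbT.
  have -> : c = (1 - t) * c + t * c by ring.
  by rewrite ltrD // ltr_pM2l // subr_gt0.
move: nadj; rewrite /hull_adjacent negb_or => /andP[ab1 ab0].
(* The crossing segment joins [a + 1] to a label outside the range from [a] to [b]: to [b + 1] if
   [a = 0], and to 0 otherwise. *)
have [a0|a0] := posnP a.
  have [x [xe xf]] : crossing p [set s a; s b] [set s a.+1; s b.+1].
    by apply: interleaved_crossing ccwp _ _; lia.
  suff: (x *m u) 0 0 < c by rewrite line // ltxx.
  by apply: below xf; lia.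
have [x [xf xe]] : crossing p [set s 0%N; s a.+1] [set s a; s b].
  by apply: interleaved_crossing ccwp _ _; lia.
suff: (x *m u) 0 0 < c by rewrite line // ltxx.
by apply: below xf; lia.
Qed.

Lemma set2_inj (T : finType) (a b c d : T) :
  [set a; b] = [set c; d] -> (a = c /\ b = d) \/ (a = d /\ b = c).
Proof.
move=> E; have := set21 a b; have := set22 a b; have := set21 c d; have := set22 c d.
rewrite -{1 2}E {3 4}E => /set2P + /set2P + /set2P + /set2P.
by do 4![case=> ?]; subst; auto.
Qed.

(* The line through a and b leaves the other segment on one side. *)
Lemma noninterleaved_noncrossing (R : realType) (n : nat) (p : 'I_n -> 'rV[R]_2)
    (s : nat -> 'I_n) (pos : 'I_n -> nat) (a b c d : nat) :
  ccw_labelling p s pos -> (a < b < n)%N -> (c < d < n)%N ->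
  ~~ [&& a < c, c < b & b < d]%N -> ~~ [&& c < a, a < d & d < b]%N ->
  (a, b) != (c, d) -> ~ crossing p [set s a; s b] [set s c; s d].
Proof.
move=> [posn posK sK ccw] abn cdn nabcd ncdab neq [x [[i [j [_ eij [t [_ xE]]]]]]].
move=> [k [l [_ ekl [t' [/andP[t'0 t'1] xE']]]]].
pose o := orient (p (s a)) (p (s b)).
have oab : o x = 0.
  rewrite xE /o /orient !mxE.
  by case: (set2_inj eij) => [[-> ->]|[-> ->]]; ring.
have ox : o x = (1 - t') * o (p k) + t' * o (p l).
  by rewrite xE' /o /orient !mxE; ring.
have u0 : 0 < 1 - t' by rewrite subr_gt0.
have : 0 != o x.
  have inside m : (a < m < b)%N -> o (p (s m)) < 0.
    by move=> amb; rewrite /o orientC oppr_lt0; apply: ccw; lia.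
  have outside m : (m < n)%N -> (m < a)%N || (b < m)%N -> 0 < o (p (s m)).
    move=> mn /orP[ma|bm]; last by apply: ccw; lia.
    by rewrite /o orient_rot; apply: ccw; lia.
  have oa : o (p (s a)) = 0 by rewrite /o /orient; ring.
  have ob : o (p (s b)) = 0 by rewrite /o /orient; ring.
  (* [o] is negative at labels strictly between [a] and [b] and positive at those outside. Without
     interleaving, [c] and [d] are weakly on the same side, and as the pairs differ one of them is
     off the line; so [o] cannot vanish at the inner point [x]. *)
  have [[oc od oo]|[oc od oo]] :
     [/\ o (p (s c)) <= 0, o (p (s d)) <= 0 & (o (p (s c)) < 0) || (o (p (s d)) < 0)]
  \/ [/\ 0 <= o (p (s c)), 0 <= o (p (s d)) & (0 < o (p (s c))) || (0 < o (p (s d)))].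
  - have [/andP[ac db]|out] := boolP ((a <= c) && (d <= b))%N.
      left; have [ca|ca] := eqVneq c a; have [db'|db'] := eqVneq d b.
      + by move: neq; rewrite ca db' eqxx.
      + by rewrite ca oa lexx inside ?orbT; [split=> //; apply/ltW/inside|]; lia.
      + by rewrite db' ob lexx inside; [split=> //; apply/ltW/inside|]; lia.
      + by rewrite inside; [split=> //; apply/ltW/inside|]; lia.
    right.
    have [ca|ca] := eqVneq c a; have [db'|db'] := eqVneq d b; try lia.
    + by rewrite ca oa lexx outside ?orbT; [split=> //; apply/ltW/outside| |]; lia.
    + by rewrite db' ob lexx outside; [split=> //; apply/ltW/outside| |]; lia.
    have [da|da] := eqVneq d a.
      by rewrite da oa lexx outside; [split=> //; apply/ltW/outside| |]; lia.
    have [cb|cb] := eqVneq c b.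
      by rewrite cb ob lexx outside ?orbT; [split=> //; apply/ltW/outside| |]; lia.
    by rewrite outside; [split=> //; apply/ltW/outside| |]; lia.
  - rewrite eq_sym lt_eqF // ox; case: (set2_inj ekl) => -[<- <-]; case/orP: oo => oo; nra.
  - rewrite lt_eqF // ox; case: (set2_inj ekl) => -[<- <-]; case/orP: oo => oo; nra.
by rewrite oab eqxx.
Qed.

(** * A triangulation on at least seven labels and a cycle avoiding it *)

(** A set of forbidden pairs independent of [n], so that the cycle can grow by induction: the pairs
    [0 b] with [5 < b] include both the ears and the closing hull edge for every [n >= 7]. *)
Definition blocked (a b : nat) : bool :=
  [|| b == a.+1, (a == 0%N) && (5 < b)%N
    | (a, b) \in [:: (1, 6); (1, 5); (2, 5); (2, 4)]%N].

Definition free_pair (a b : nat) : bool := ~~ blocked a b && ~~ blocked b a.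

(** For [n > 7] the heptagon side [06] becomes a diagonal, so the fan at 0 starts with 6; it stops
    at [n - 2], and is empty for [n = 7]. *)
Definition chords (n : nat) : seq (nat * nat) :=
  [:: (1, 6); (1, 5); (2, 5); (2, 4)]%N ++ [seq (0%N, k) | k <- iota 6 (n - 7)].

(** The cycle [X ++ Y] is marked at two places where a vertex can be inserted. Up to rotation the
    new cycle is [X], new vertex, [Y]; swapping the halves makes the other mark the next place of
    insertion. *)
Fixpoint free_cycle_halves (m : nat) : seq nat * seq nat :=
  if m is m'.+1 then
    let: (X, Y) := free_cycle_halves m' in ((m' + 7)%N :: Y, X)
  else ([:: 5; 0; 2; 6; 4]%N, [:: 1; 3]%N).

(* The new vertex n goes between the two halves; it is not joined to 0 or n - 1
   because the first half ends in 3 or 4 and the second one starts with 1, 5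
   or n - 2. *)
Lemma free_cycle_halvesP (m : nat) : let: (X, Y) := free_cycle_halves m in
  [/\ perm_eq (X ++ Y) (iota 0 (m + 7)), cycle free_pair (X ++ Y),
      last 0%N X \in [:: 3; 4]%N, last 0%N Y \in [:: 3; 4]%N &
      exists y Y', Y = y :: Y' /\ (0 < y < m + 6)%N /\
      exists x X', X = x :: X' /\ (0 < x < m + 7)%N].
Proof.
elim: m => [|m]; first by split=> //; exists 1%N, [:: 3]; split=> //; split=> //;
  exists 5%N, [:: 0; 2; 6; 4].
rewrite addSn [free_cycle_halves _.+1]/=.
case: (free_cycle_halves m) => X Y [pe cy lX lY [y [Y' [eY [yl [x [X' [eX xl]]]]]]]].
subst X Y; split=> //.
- rewrite -[X in iota 0 X]addn1 iotaD add0n perm_sym perm_catC perm_cons perm_sym.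
  by rewrite (perm_catC (y :: Y') (x :: X')).
- move: cy lX lY; rewrite /= !rcons_cat !cat_path /= !rcons_path /=.
  rewrite !inE.
  case/and4P=> px _ py fx lX lY; apply/and5P; split=> //; last first.
    by rewrite /free_pair /blocked !inE /= !xpair_eqE; lia.
  by rewrite /free_pair /blocked !inE /= !xpair_eqE; lia.
- exists x, X'; split=> //; split; first by lia.
  by exists (m + 7)%N, (y :: Y'); split=> //; lia.
Qed.

Lemma free_cycle_exists (n : nat) : (6 < n)%N ->
  exists c, perm_eq c (iota 0 n) /\ cycle free_pair c.
Proof.
move=> n7; have := free_cycle_halvesP (n - 7); rewrite subnK //.
by case: free_cycle_halves => X Y [pe cy _ _ _]; exists (X ++ Y).
Qed.

Lemma chords_size (n : nat) : (6 < n)%N -> size (chords n) = (n - 3)%N.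
Proof. by move=> n7; rewrite size_cat size_map size_iota /=; lia. Qed.

Lemma chords_uniq (n : nat) : uniq (chords n).
Proof.
rewrite cat_uniq map_inj_uniq ?iota_uniq; last by move=> ? ? [].
rewrite andbT /=; apply/hasPn => -[a b] /mapP[k _ [-> ->]].
by rewrite !inE !xpair_eqE.
Qed.

Lemma chordsP (n : nat) (a b : nat) : (6 < n)%N -> (a, b) \in chords n ->
  [/\ (a < b < n)%N, blocked a b, ~~ hull_adjacent n a b &
   (a, b) \in [:: (1, 6); (1, 5); (2, 5); (2, 4)]%N \/ a = 0%N /\ (5 < b)%N].
Proof.
move=> n7; rewrite mem_cat => /orP[ab|/mapP[k]].
  split; rewrite ?/blocked ?ab ?orbT //; last by left.
    by move: ab; rewrite !inE !xpair_eqE; lia.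
  by move: ab; rewrite !inE !xpair_eqE /hull_adjacent; lia.
rewrite mem_iota => kl [-> ->].
split; rewrite /blocked /hull_adjacent; [lia..|right; lia].
Qed.

Lemma chords_noninterleaved (n a b c d : nat) : (6 < n)%N ->
  (a, b) \in chords n -> (c, d) \in chords n -> ~~ [&& a < c, c < b & b < d]%N.
Proof.
move=> n7 /(chordsP n7)[_ _ _ ab] /(chordsP n7)[_ _ _ cd].
by move: ab cd; rewrite !inE !xpair_eqE; lia.
Qed.

Lemma hull_adjacent_blocked (n a b : nat) :
  (6 < n)%N -> hull_adjacent n a b -> blocked a b.
Proof. by rewrite /hull_adjacent /blocked; lia. Qed.

(** * From labels back to points: the case of at least seven points *)

Lemma ccw_labelling_pair (R : realType) (n : nat) (p : 'I_n -> 'rV[R]_2)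
    (s : nat -> 'I_n) (pos : 'I_n -> nat) (e : {set 'I_n}) :
  ccw_labelling p s pos -> #|e| = 2%N ->
  exists a b, (a < b < n)%N /\ e = [set s a; s b].
Proof.
move=> [posn posK sK _] /eqP/cards2P[x [y [xy ->]]].
have := posn x; have := posn y.
have [xy'|yx|pxy] := ltngtP (pos x) (pos y) => py px.
- by exists (pos x), (pos y); rewrite !posK; split=> //; lia.
- by exists (pos y), (pos x); rewrite !posK setUC; split=> //; lia.
- by move: xy; rewrite -[x]posK pxy posK eqxx.
Qed.

Lemma cycle_graph_size (V : finType) (c : seq V) :
  uniq c -> (forall x, x \in c) -> size c = #|V|.
Proof.
by move=> uc mc; rewrite -(card_uniqP uc); apply: eq_card => x; rewrite mc.
Qed.

Lemma imset_pair (T U : finType) (h : T -> U) (x y : T) :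
  [set h z | z in [set x; y]] = [set h x; h y].
Proof. by rewrite imsetU !imset_set1. Qed.

Lemma cycle_potentially_triangulable (R : realType) (n : nat)
    (p : 'I_n -> 'rV[R]_2) (s : nat -> 'I_n) (pos : 'I_n -> nat)
    (V : finType) (F : sgraph V) :
  (6 < n)%N -> ccw_labelling p s pos -> #|V| = n -> is_cycle_graph F ->
  potentially_triangulable p F.
Proof.
move=> n7 ccwp hV [c [uc mc eF]].
have [posn posK sK _] := ccwp.
have [l [pl cyl]] := free_cycle_exists n7.
have sc : size c = n by rewrite (cycle_graph_size uc mc).
have sl : size l = n by rewrite (perm_size pl) size_iota.
have ul : uniq l by rewrite (perm_uniq pl) iota_uniq.
have ic y : (index y c < n)%N by rewrite -[X in (_ < X)%N]sc index_mem.
(* The given cycle is laid along the free cycle [l], entry by entry, so each of its edges becomes a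
   free pair. *)
pose f y := nth 0%N l (index y c).
have fn y : (f y < n)%N.
  by have := mem_nth 0%N (s := l) (n := index y c); rewrite sl => /(_ (ic y));
    rewrite (perm_mem pl) mem_iota.
have finj : injective f.
  move=> x y /eqP; rewrite nth_uniq ?sl // => /eqP exy.
  by rewrite -[x](nth_index x (mc x)) exy nth_index.
have fc : map f c = l.
  apply: (@eq_from_nth _ 0%N); rewrite size_map sc // => i ni.
  have [y yc] : exists y : V, y \in c by case: (c) sc mc ni => [<-|y c' _ mc' _] //; exists y.
  by rewrite (nth_map y) ?sc // /f index_uniq ?sc.
have ffree y : free_pair (f y) (f (next c y)).
  by move: cyl; rewrite -fc cycle_map => /next_cycle/(_ (mc y)).
have hinj : injective (s \o f).
  by move=> x y /= /(congr1 pos); rewrite !sK // => /finj.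
have sneq a b : (a < b < n)%N -> s a != s b.
  by move=> abn; apply/eqP => /(congr1 pos); rewrite !sK; lia.
exists (s \o f); split=> //.
have inG a b : (a < b < n)%N -> blocked a b -> [set s a; s b] \in
    complete_edges n :\: [set [set (s \o f) x | x in e] | e : {set V} in edges F].
  move=> abn bl; rewrite !inE cards2 sneq // andbT.
  apply/imsetP => -[e]; rewrite eF => /imsetP[y _ ->].
  rewrite imset_pair /=; have := ffree y; rewrite /free_pair => /andP[f1 f2].
  move=> /set2_inj[[]|[]] /(congr1 pos) E1 /(congr1 pos) E2; move: E1 E2.
    by rewrite !sK ?fn //; [move=> E1 E2; move: bl f1; rewrite E1 E2 => -> | lia..].
  by rewrite !sK ?fn //; [move=> E1 E2; move: bl f2; rewrite E1 E2 => -> | lia..].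
split.
  move=> e be; have [a [b [abn ee]]] : exists a b, (a < b < n)%N /\ e = [set s a; s b].
    apply: ccw_labelling_pair ccwp _.
    by case: be => i [j [ij -> _]]; rewrite cards2 ij.
  subst e; apply: inG => //; apply: hull_adjacent_blocked n7 _.
  exact: boundary_hull_adjacent ccwp abn be.
pose D := [seq [set s ab.1; s ab.2] | ab <- chords n].
have uD : uniq D.
  rewrite map_inj_in_uniq ?chords_uniq // => -[a b] [a' b'].
  move=> /(chordsP n7)[abn _ _ _] /(chordsP n7)[abn' _ _ _] /=.
  move=> /set2_inj[[]|[]] /(congr1 pos) E1 /(congr1 pos) E2; move: E1 E2;
    rewrite !sK; first [lia | by move=> -> ->].
have DP e : e \in [set:: D] -> exists a b, (a, b) \in chords n /\ e = [set s a; s b].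
  by rewrite inE => /mapP[[a b] ab ->]; exists a, b.
exists [set:: D]; split.
- apply/subsetP => e /DP[a [b [/(chordsP n7)[abn bl _ _] ->]]].
  exact: inG.
- by rewrite cardsE (card_uniqP uD) size_map chords_size.
- move=> e /DP[a [b [/(chordsP n7)[abn _ nadj _] ->]]].
  split; first by rewrite cards2 sneq.
  by move/(boundary_hull_adjacent ccwp abn); apply/negP.
- move=> e e' /DP[a [b [ab ->]]] /DP[a' [b' [ab' ->]]] ne.
  have [abn _ _ _] := chordsP n7 ab; have [abn' _ _ _] := chordsP n7 ab'.
  apply: (noninterleaved_noncrossing ccwp) => //.
  + exact: chords_noninterleaved ab ab'.
  + exact: chords_noninterleaved ab' ab.
  + by apply: contra ne => /eqP[-> ->].
Qed.

(** * Impossibility for at most six points *)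

Lemma next_neq_prev (T : eqType) (c : seq T) (x : T) :
  uniq c -> (2 < size c)%N -> x \in c -> next c x != prev c x.
Proof.
move=> uc sc /rot_to[i c' E].
rewrite -(next_rot i uc) -(prev_rot i uc).
move: uc sc; rewrite -(rot_uniq i) -(size_rot i) E.
case: c' {E} => [|y [|z c']] // /andP[xc /andP[yc _]] _.
rewrite next_nth prev_nth mem_head; have /= -> := memNindex xc; rewrite eqxx /=.
rewrite -[size c']/(size (z :: c')).-1 nth_last.
by apply: contra yc => /eqP->; rewrite /= mem_last.
Qed.

Lemma uniq_bounded_size (n : nat) (t : seq nat) :
  uniq t -> all (gtn n) t -> (size t <= n)%N.
Proof.
move=> ut /allP tn; rewrite -[X in (_ <= X)%N](size_iota 0).
by apply: uniq_leq_size ut _ => i /tn; rewrite mem_iota.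
Qed.

(** The hexagon has only nine diagonals, so all triples of them are checked by computation. *)
Lemma no_hexagon_matching (a b a' b' a'' b'' : nat) :
  (a < b < 6)%N -> (a' < b' < 6)%N -> (a'' < b'' < 6)%N ->
  ~~ hull_adjacent 6 a b -> ~~ hull_adjacent 6 a' b' ->
  ~~ hull_adjacent 6 a'' b'' -> uniq [:: a; b; a'; b'; a''; b''] ->
  ~~ [&& a < a', a' < b & b < b']%N -> ~~ [&& a' < a, a < b' & b' < b]%N ->
  ~~ [&& a < a'', a'' < b & b < b'']%N -> ~~ [&& a'' < a, a < b'' & b'' < b]%N ->
  ~~ [&& a' < a'', a'' < b' & b' < b'']%N ->
  ~~ [&& a'' < a', a' < b'' & b'' < b']%N -> False.
Proof.
pose H := [:: (0, 2); (0, 3); (0, 4); (1, 3); (1, 4); (1, 5); (2, 4); (2, 5); (3, 5)]%N.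
have inH i j : (i < j < 6)%N -> ~~ hull_adjacent 6 i j -> (i, j) \in H.
  by rewrite /hull_adjacent !inE !xpair_eqE; lia.
pose cross (f g : nat * nat) := [&& f.1 < g.1, g.1 < f.2 & f.2 < g.2]%N.
have none : all (fun f => all (fun g => all (fun h =>
    ~~ [&& uniq [:: f.1; f.2; g.1; g.2; h.1; h.2], ~~ cross f g, ~~ cross g f,
      ~~ cross f h, ~~ cross h f, ~~ cross g h & ~~ cross h g]) H) H) H by [].
move=> l1 l2 l3 /(inH _ _ l1) m1 /(inH _ _ l2) m2 /(inH _ _ l3) m3 u ? ? ? ? ? ?.
have /allP/(_ _ m2)/allP/(_ _ m3)/negP := allP none _ m1; apply.
by apply/and5P; split=> //; apply/and3P.
Qed.

Lemma cycle_not_potentially_triangulable (R : realType) (n : nat)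
    (p : 'I_n -> 'rV[R]_2) (s : nat -> 'I_n) (pos : 'I_n -> nat)
    (V : finType) (F : sgraph V) :
  (2 < n < 7)%N -> ccw_labelling p s pos -> #|V| = n -> is_cycle_graph F ->
  ~ potentially_triangulable p F.
Proof.
move=> n37 ccwp hV [c [uc mc eF]] [h [hinj [bdG [D [DG cD Ddiag Dnc]]]]].
have [posn posK sK _] := ccwp.
have sc : size c = n by rewrite (cycle_graph_size uc mc).
have [g hK gK] : bijective h by apply: inj_card_bij => //; rewrite card_ord hV.
set G := _ :\: _ in bdG DG.
have GF y : [set h y; h (next c y)] \notin G.
  rewrite inE negb_and negbK -imset_pair imset_f // eF.
  exact: imset_f.
clearbody G.
have Dpair e : e \in D -> exists a b,
    [/\ (a < b < n)%N, e = [set s a; s b] & ~~ hull_adjacent n a b].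
  move=> eD; have [e2 nbd] := Ddiag e eD.
  have [a [b [abn ee]]] := ccw_labelling_pair ccwp e2.
  exists a, b; split=> //; apply/negP => adj; apply: nbd; rewrite ee.
  exact: hull_adjacent_boundary ccwp abn adj.
have adjG a b : (a < b < n)%N -> hull_adjacent n a b -> [set s a; s b] \in G.
  by move=> abn adj; apply: bdG; apply: hull_adjacent_boundary ccwp abn adj.
have adjD a b : (a < b < n)%N -> hull_adjacent n a b -> [set s a; s b] \notin D.
  move=> abn adj; apply/negP => /Ddiag[_]; apply.
  exact: hull_adjacent_boundary ccwp abn adj.
have hull_nbrs v : (v < n)%N -> exists b b',
    [/\ uniq [:: v; b; b'], (b < n)%N, (b' < n)%N &
      forall u, u \in [:: b; b'] -> [set s v; s u] \in G /\ [set s v; s u] \notin D].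
  move=> vn.
  pose b := if v.+1 == n then 0%N else v.+1.
  pose b' := if v == 0%N then n.-1 else v.-1.
  exists b, b'; rewrite /b /b'; split; try by do ?[case: eqP => ?]; rewrite /= ?inE; lia.
  move=> u; rewrite !inE => /orP[]/eqP->.
  - case: eqP => e.
      by rewrite setUC; split; [apply: adjG | apply: adjD]; rewrite /hull_adjacent; lia.
    by split; [apply: adjG | apply: adjD]; rewrite /hull_adjacent; lia.
  - case: eqP => e.
      by split; [apply: adjG | apply: adjD]; rewrite /hull_adjacent; lia.
    by rewrite setUC; split; [apply: adjG | apply: adjD]; rewrite /hull_adjacent; lia.
have cycle_nbrs v : (v < n)%N -> exists a a',
    [/\ uniq [:: v; a; a'], (a < n)%N, (a' < n)%N &
      forall u, u \in [:: a; a'] -> [set s v; s u] \notin G].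
  move=> vn; pose y := g (s v); have hy : h y = s v by rewrite gK.
  have pinj x z : pos (h x) = pos (h z) -> x = z.
    by move=> /(congr1 s); rewrite !posK => /hinj.
  have nxt x : x != next c x.
    have : [set x; next c x] \in edges F by rewrite eF; apply: imset_f.
    by move=> /edges_card2; rewrite cards2; case: (x != _).
  exists (pos (h (next c y))), (pos (h (prev c y))); split=> //.
    rewrite /= !inE negb_or andbT -[v]sK // -hy; apply/andP; split; first (apply/andP; split).
    - by apply/eqP => /pinj/eqP; apply/negP.
    - by apply/eqP => /pinj/eqP; apply/negP; rewrite eq_sym -{2}[y](next_prev uc).
    - by apply/eqP => /pinj/eqP; apply/negP/next_neq_prev; rewrite ?sc //; case/andP: n37.
  move=> u; rewrite !inE => /orP[]/eqP->; rewrite posK -hy; first exact: GF.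
  by rewrite setUC -{2}[y](next_prev uc); apply: GF.
(* The list [t] holds the two hull neighbours and the two cycle neighbours of [v]. They are four
   distinct labels because hull edges belong to [G] and edges of the cycle do not. *)
have nbrs v : (v < n)%N -> exists t, [/\ size t = 4%N, uniq (v :: t), all (gtn n) t
    & forall u, [set s v; s u] \in D -> u \notin t].
  move=> vn; have [b [b' [ub bn bn' bG]]] := hull_nbrs v vn.
  have [a [a' [ua an an' aG]]] := cycle_nbrs v vn.
  have ba x z : x \in [:: b; b'] -> z \in [:: a; a'] -> z != x.
    by move=> /bG[xG _] /aG zG; apply: contra zG => /eqP->.
  exists [:: a; a'; b; b']; split=> //.
  - move: ua ub; rewrite /= !inE !negb_or !andbT.
    move=> /andP[/andP[-> ->] ->] /andP[/andP[-> ->] ->].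
    by rewrite !ba ?inE ?eqxx ?orbT.
  - by rewrite /= an an' bn bn'.
  - move=> u uD; rewrite -[X in _ \notin X]/([:: a; a'] ++ [:: b; b']) mem_cat negb_or.
    apply/andP; split; first by apply/negP => /aG; rewrite (subsetP DG).
    by apply/negP => /bG[_]; rewrite uD.
have n5 : (4 < n)%N.
  have [|t [st ut tn _]] := nbrs 0%N; first by lia.
  by have := @uniq_bounded_size n _ ut; rewrite /= tn st andbT => -> //; case/andP: n37 => /ltnW/ltnW.
have [e1 e1D] : exists e, e \in D by apply/card_gt0P; rewrite cD; lia.
(* The other end of a diagonal at [a] is a sixth label, besides [a] and its four excluded
   neighbours. *)
have n6 : n = 6%N.
  have [a [b [abn ee _]]] := Dpair _ e1D; subst e1.
  have [|t [st ut tn tD]] := nbrs a; first by lia.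
  have := @uniq_bounded_size n [:: b, a & t].
  move: ut; rewrite /= inE negb_or (tD b) // tn st andbT => -> /=.
  by lia.
(* Two diagonals at [v] would require seven labels below 6, so the diagonals of [D] are pairwise
   disjoint. *)
have disj v u u' : (v < n)%N -> (u < n)%N -> (u' < n)%N -> v != u -> v != u' ->
    [set s v; s u] \in D -> [set s v; s u'] \in D -> u = u'.
  move=> vn un un' vu vu' uD uD'; apply/eqP/negPn/negP => nuu.
  have [t [st ut tn tD]] := nbrs v vn.
  have := @uniq_bounded_size n [:: u', u, v & t].
  move: ut; rewrite /= !inE !negb_or (tD u) // (tD u') // tn st => ->.
  by rewrite un un' vn ![_ == v]eq_sym vu vu' [u' == u]eq_sym nuu n6 => /(_ isT isT).
have lt3 a b : (a < b < n)%N -> [/\ (a < n)%N, (b < n)%N & a != b].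
  by clear; move=> abn; split; lia.
have sym a b : [set s a; s b] \in D -> [set s b; s a] \in D by rewrite setUC.
have disjoint a b a' b' : (a < b < n)%N -> (a' < b' < n)%N ->
    [set s a; s b] \in D -> [set s a'; s b'] \in D ->
    [set s a; s b] != [set s a'; s b'] -> [&& a != a', a != b', b != a' & b != b'].
  move=> /lt3[an bn ab] /lt3[an' bn' ab'] eD eD' ne.
  apply/and4P; split; apply: contra ne => /eqP E; apply/eqP.
  - by subst a'; congr [set _; s _]; apply: (disj a).
  - subst b'; rewrite [RHS]setUC; congr [set _; s _].
    by apply: (disj a) => //; [rewrite eq_sym | exact: sym].
  - subst a'; rewrite setUC; congr [set _; s _].
    by apply: (disj b) => //; [rewrite eq_sym | exact: sym].
  - subst b'; congr [set s _; _].
    by apply: (disj b); rewrite ?[b == _]eq_sym //; apply: sym.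
have nonint a b a' b' : (a < b < n)%N -> (a' < b' < n)%N ->
    [set s a; s b] \in D -> [set s a'; s b'] \in D ->
    [set s a; s b] != [set s a'; s b'] -> ~~ [&& a < a', a' < b & b < b']%N.
  move=> abn abn' eD eD' ne; apply/negP => int.
  by apply: (Dnc _ _ eD eD' ne); apply: interleaved_crossing ccwp _ _; lia.
have /card_gt2P[e [e' [e'' [[eD eD' eD''] [ne ne' ne'']]]]] : (2 < #|D|)%N.
  by rewrite cD n6.
have [a [b [abn ee nadj]]] := Dpair e eD.
have [a' [b' [abn' ee' nadj']]] := Dpair e' eD'.
have [a'' [b'' [abn'' ee'' nadj'']]] := Dpair e'' eD''.
subst e e' e''.
have d1 := disjoint _ _ _ _ abn abn' eD eD' ne.
have d2 := disjoint _ _ _ _ abn' abn'' eD' eD'' ne'.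
have i1 := nonint _ _ _ _ abn abn' eD eD' ne.
have i2 := nonint _ _ _ _ abn' abn'' eD' eD'' ne'.
have i3 := nonint _ _ _ _ abn'' abn eD'' eD ne''.
(* Each pair of diagonals is needed in both orders, since [nonint] excludes only one of the two
   interleavings. *)
rewrite eq_sym in ne; rewrite eq_sym in ne'; rewrite eq_sym in ne''.
have d3 := disjoint _ _ _ _ abn abn'' eD eD'' ne''.
have i4 := nonint _ _ _ _ abn' abn eD' eD ne.
have i5 := nonint _ _ _ _ abn'' abn' eD'' eD' ne'.
have i6 := nonint _ _ _ _ abn abn'' eD eD'' ne''.
have [[_ _ ab] [_ _ ab'] [_ _ ab'']] := And3 (lt3 _ _ abn) (lt3 _ _ abn') (lt3 _ _ abn'').
move: d1 d2 d3 => /and4P[x1 x2 x3 x4] /and4P[y1 y2 y3 y4] /and4P[z1 z2 z3 z4].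
rewrite n6 in abn abn' abn'' nadj nadj' nadj''.
apply: (no_hexagon_matching abn abn' abn'') => //.
by rewrite /= !inE !negb_or ab ab' ab'' x1 x2 x3 x4 y1 y2 y3 y4 z1 z2 z3 z4.
Qed.

Theorem theorem4 (R : realType) (n : nat) (hn : (3 <= n)%N)
    (p : 'I_n -> 'rV[R]_2) (hp : convex_position p)
    (V : finType) (hV : #|V| = n) (F : sgraph V) (hF : is_cycle_graph F) :
  potentially_triangulable p F <-> (7 <= n)%N.
Proof.
have [s [pos ccwp]] : exists (s : nat -> 'I_n) (pos : 'I_n -> nat), ccw_labelling p s pos.
  by apply: ccw_labelling_exists hp; apply: leq_trans hn.
split=> [pt|n7]; last exact: cycle_potentially_triangulable ccwp hV hF.
rewrite leqNgt; apply/negP => n7.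
by apply: cycle_not_potentially_triangulable ccwp hV hF pt; rewrite hn.
Qed.
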